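(* Let $\mathcal S=\{1,2,3,4,5,6,7\}$ and $T=\{\{1,2,3\},\{1,4,5\},\{1,6,7\},\{2,4,6\},\{2,5,7\},\{3,4,7\},\{3,5,6\}\}$ (the Fano plane Steiner triple system). Consider the following four orientations of $(\mathcal S,T)$: $$\mathcal O_1(T)=\{[1,2,3],[1,4,5],[1,6,7],[2,4,6],[2,7,5],[3,6,5],[3,7,4]\},$$ $$\mathcal O_2(T)=\{[1,2,3],[1,4,5],[1,7,6],[2,4,6],[2,5,7],[3,4,7],[3,6,5]\},$$ $$\mathcal O_3(T)=\{[1,2,3],[1,4,5],[1,6,7],[2,4,6],[2,5,7],[3,4,7],[3,5,6]\},$$ $$\mathcal O_4(T)=\{[1,2,3],[1,4,5],[1,6,7],[2,4,6],[2,5,7],[3,4,7],[3,6,5]\}.$$ Then there are exactly four isomorphism classes of oriented Steiner triple systems on seven points, and $(\mathcal S,\mathcal O_1(T)),\dots,(\mathcal S,\mathcal O_4(T))$ are representatives of these four classes (pairwise non-isomorphic, and every oriented Steiner triple system on seven points is isomorphic to one of them). Moreover: $\mathrm{Aut}(\mathcal S,\mathcal O_1(T))$ and $\mathrm{Aut}(\mathcal S,\mathcal O_2(T))$ are non-Abelian groups of order $21$; $\mathrm{Aut}(\mathcal S,\mathcal O_3(T))$ and $\mathrm{Aut}(\mathcal S,\mathcal O_4(T))$ are cyclic of order $3$; none of the four classes is reflexive; and $(\mathcal S,\overline{\mathcal O_1}(T))\cong(\mathcal S,\mathcal O_2(T))$ and $(\mathcal S,\overline{\mathcal O_3}(T))\cong(\mathcal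 S,\mathcal O_4(T))$.
   Context: A Steiner triple system $(\mathcal S,T)$ consists of a finite set $\mathcal S$ and a collection $T$ of 3-element subsets of $\mathcal S$ (triples) such that every 2-element subset of $\mathcal S$ is contained in exactly one triple. An oriented Steiner triple system $(\mathcal S,\mathcal O(T))$ is a Steiner triple system in which each triple $\{a,b,c\}$ is assigned one of its two cyclic orderings; $[a,b,c]$ denotes the cyclic ordering $a\to b\to c\to a$, so $[a,b,c]=[b,c,a]=[c,a,b]$, while $[a,c,b]$ is the opposite ordering. Two oriented Steiner triple systems $(\mathcal S,\mathcal O(T))$, $(\mathcal S',\mathcal O'(T'))$ are isomorphic if there is a bijection $\phi:\mathcal S\to\mathcal S'$ with $[s,s',s'']\in\mathcal O(T)$ iff $[\phi(s),\phi(s'),\phi(s'')]\in\mathcal O'(T')$. $\mathrm{Aut}(\mathcal S,\mathcal O(T))$ is the group of isomorphisms from the system to itself. $\overline{\mathcal O}(T)$ denotes the orientation obtained by reversing the cyclic ordering of every triple of $\mathcal O(T)$; the system is called reflexive if $(\mathcal S,\mathcal O(T))\cong(\mathcal S,\overline{\mathcal O}(T))$. *)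

(* Defs.v *)
From mathcomp Require Import all_boot all_order all_fingroup all_solvable.

Set Implicit Arguments.
Unset Strict Implicit.
Unset Printing Implicit Defensive.

Definition steiner_triple_system (S : finType) (T : {set {set S}}) : bool :=
  [forall t in T, #|t| == 3] &&
  [forall e : {set S}, (#|e| == 2) ==> (#|[set t in T | e \subset t]| == 1)].

(* The cyclic ordering a -> b -> c -> a is the set of its three rotations, so
   that cyc a b c = cyc b c a = cyc c a b, whereas cyc a c b is different when
   a, b, c are distinct. *)
Definition cyc (S : finType) (a b c : S) : {set S * S * S} :=
  [set (a, b, c); (b, c, a); (c, a, b)].

(* If #|t| = 3 this set has exactly two elements. *)
Definition cyclic_orderings (S : finType) (t : {set S}) :
    {set {set S * S * S}} :=
  [set cyc x.1.1 x.1.2 x.2 |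
     x : S * S * S & [set x.1.1; x.1.2; x.2] == t].

Definition orientation (S : finType) (T : {set {set S}})
    (O : {set {set S * S * S}}) : bool :=
  (O \subset \bigcup_(t in T) cyclic_orderings t) &&
  [forall t in T, #|O :&: cyclic_orderings t| == 1].

Definition oriented_STS (S : finType) (T : {set {set S}})
    (O : {set {set S * S * S}}) : bool :=
  steiner_triple_system T && orientation T O.

(* T is the set of supports of the elements of O, so isomorphisms,
   automorphisms and reversal are functions of O alone. *)
Definition preserves_orientation (S S' : finType)
    (O : {set {set S * S * S}}) (O' : {set {set S' * S' * S'}})
    (phi : S -> S') : bool :=
  [forall a, forall b, forall c,
     (cyc a b c \in O) == (cyc (phi a) (phi b) (phi c) \in O')].

Definition isomorphic (S S' : finType)
    (O : {set {set S * S * S}}) (O' : {set {set S' * S' * S'}}) : Prop :=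
  exists2 phi : S -> S', bijective phi & preserves_orientation O O' phi.

Definition oaut (S : finType) (O : {set {set S * S * S}}) : {set {perm S}} :=
  [set s : {perm S} | preserves_orientation O O s].

Lemma oaut_group_set (S : finType) (O : {set {set S * S * S}}) :
  group_set (oaut O).
Proof.
apply/group_setP; split=> [|s t].
  by rewrite inE; apply/'forall_'forall_'forall_eqP => a b c; rewrite !perm1.
rewrite !inE => /'forall_'forall_'forall_eqP Hs /'forall_'forall_'forall_eqP Ht.
by apply/'forall_'forall_'forall_eqP => a b c; rewrite !permM Hs Ht.
Qed.

Canonical oaut_group (S : finType) (O : {set {set S * S * S}}) :
  {group {perm S}} := Group (oaut_group_set O).

Definition reverse_cyc (S : finType) (C : {set S * S * S}) :
    {set S * S * S} :=
  [set (x.2, x.1.2, x.1.1) | x in C].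

Definition reverse (S : finType) (O : {set {set S * S * S}}) :
    {set {set S * S * S}} :=
  [set reverse_cyc C | C in O].

Definition reflexive_orientation (S : finType) (O : {set {set S * S * S}}) :
    Prop :=
  isomorphic O (reverse O).

(* The points 1, ..., 7 are the elements 0, ..., 6 of 'I_7: k : 'I_7 carries
   the label k + 1. *)
Notation pt k := (@Ordinal 7 k.-1 isT) (only parsing).

Definition tri (a b c : 'I_7) : {set 'I_7} := [set a; b; c].

Definition fano : {set {set 'I_7}} :=
  [set t in [:: tri (pt 1) (pt 2) (pt 3); tri (pt 1) (pt 4) (pt 5);
                tri (pt 1) (pt 6) (pt 7); tri (pt 2) (pt 4) (pt 6);
                tri (pt 2) (pt 5) (pt 7); tri (pt 3) (pt 4) (pt 7);
                tri (pt 3) (pt 5) (pt 6)]].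

Definition O1 : {set {set 'I_7 * 'I_7 * 'I_7}} :=
  [set C in [:: cyc (pt 1) (pt 2) (pt 3); cyc (pt 1) (pt 4) (pt 5);
                cyc (pt 1) (pt 6) (pt 7); cyc (pt 2) (pt 4) (pt 6);
                cyc (pt 2) (pt 7) (pt 5); cyc (pt 3) (pt 6) (pt 5);
                cyc (pt 3) (pt 7) (pt 4)]].

Definition O2 : {set {set 'I_7 * 'I_7 * 'I_7}} :=
  [set C in [:: cyc (pt 1) (pt 2) (pt 3); cyc (pt 1) (pt 4) (pt 5);
                cyc (pt 1) (pt 7) (pt 6); cyc (pt 2) (pt 4) (pt 6);
                cyc (pt 2) (pt 5) (pt 7); cyc (pt 3) (pt 4) (pt 7);
                cyc (pt 3) (pt 6) (pt 5)]].

Definition O3 : {set {set 'I_7 * 'I_7 * 'I_7}} :=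
  [set C in [:: cyc (pt 1) (pt 2) (pt 3); cyc (pt 1) (pt 4) (pt 5);
                cyc (pt 1) (pt 6) (pt 7); cyc (pt 2) (pt 4) (pt 6);
                cyc (pt 2) (pt 5) (pt 7); cyc (pt 3) (pt 4) (pt 7);
                cyc (pt 3) (pt 5) (pt 6)]].

Definition O4 : {set {set 'I_7 * 'I_7 * 'I_7}} :=
  [set C in [:: cyc (pt 1) (pt 2) (pt 3); cyc (pt 1) (pt 4) (pt 5);
                cyc (pt 1) (pt 6) (pt 7); cyc (pt 2) (pt 4) (pt 6);
                cyc (pt 2) (pt 5) (pt 7); cyc (pt 3) (pt 4) (pt 7);
                cyc (pt 3) (pt 6) (pt 5)]].

(* Main.v *)
Require Import Defs.
From mathcomp Require Import all_boot all_order all_fingroup all_solvable.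

(* A Steiner triple system on seven points is a Fano plane: choose points
   a, b, d that do not lie in a common triple; then the third points
   c, e, f, g of ab, ad, bd, cd exhaust the remaining ones and force the other
   three triples.  An orientation is thus one of 2^7 choices of signs, and an
   isomorphism between two orientations is one of 7! permutations, so that
   everything else is a finite search, carried out on natural numbers. *)

Set Implicit Arguments.
Unset Strict Implicit.
Unset Printing Implicit Defensive.

(** * Orientations as lists of ordered triples up to rotation *)

Definition map3 (T T' : Type) (f : T -> T') (t : T * T * T) : T' * T' * T' :=
  (f t.1.1, f t.1.2, f t.2).
Definition points (T : Type) (t : T * T * T) : seq T := [:: t.1.1; t.1.2; t.2].
Definition cyclic_shifts (T : Type) (t : T * T * T) : seq (T * T * T) :=
  [:: t; (t.1.2, t.2, t.1.1); (t.2, t.1.1, t.1.2)].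
(** Up to rotation this is the opposite cyclic ordering; keeping the first entry in place lets
    triples of [L1] to [L4] be compared literally. *)
Definition flip (T : Type) (t : T * T * T) : T * T * T := (t.1.1, t.2, t.1.2).

Definition sub_cyclic (T : eqType) (l l' : seq (T * T * T)) : bool :=
  all (fun t => has (fun u => t \in cyclic_shifts u) l') l.
Definition same_cyclic (T : eqType) (l l' : seq (T * T * T)) : bool :=
  sub_cyclic l l' && sub_cyclic l' l.

Lemma map3_inj (T T' : Type) (f : T -> T') : injective f -> injective (map3 f).
Proof. by move=> fI [[a b] c] [[a' b'] c'] [/fI -> /fI -> /fI ->]. Qed.

Lemma mem_cyclic_shifts_map3 (T T' : eqType) (f : T -> T') t u : injective f ->
  (map3 f t \in cyclic_shifts (map3 f u)) = (t \in cyclic_shifts u).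
Proof.
by move=> fI; rewrite -(mem_map (map3_inj fI)); case: u => [[a b] c].
Qed.

Lemma same_cyclic_map (T T' : eqType) (f : T -> T') l l' : injective f ->
  same_cyclic (map (map3 f) l) (map (map3 f) l') = same_cyclic l l'.
Proof.
move=> fI; rewrite /same_cyclic /sub_cyclic !all_map.
by congr (_ && _); apply: eq_all => t /=; rewrite has_map; apply: eq_has => u /=;
  rewrite mem_cyclic_shifts_map3.
Qed.

Definition cyc3 (T : finType) (t : T * T * T) := cyc t.1.1 t.1.2 t.2.
Definition orient (T : finType) (l : seq (T * T * T)) := [set C in map (@cyc3 T) l].
Definition supp (T : finType) (t : T * T * T) : {set T} := [set t.1.1; t.1.2; t.2].

Section Orient.
Variable T : finType.
Implicit Types (t u : T * T * T) (l : seq (T * T * T)).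

(** [t] lies in its own set of rotations, so equality of the two sets puts it among the shifts of
    [u]. A comparison of sets thus becomes a test on triples that can be evaluated. *)
Lemma eq_cyc3 t u : (cyc3 t == cyc3 u) = (t \in cyclic_shifts u).
Proof.
case: t u => [[a b] c] [[a' b'] c']; apply/eqP/idP => [E|]; last first.
  rewrite !inE /cyc3 /= => /or3P[]/eqP[-> -> ->] //; apply/setP=> x;
  by rewrite !inE; do 3!case: (x == _).
have: (a, b, c) \in cyc3 (a', b', c') by rewrite -E !inE eqxx.
by rewrite !inE orbA.
Qed.

Lemma mem_orient t l : (cyc3 t \in orient l) = has (fun u => t \in cyclic_shifts u) l.
Proof.
rewrite inE; apply/mapP/hasP => [[u lu /eqP]|[u lu tu]]; first by rewrite eq_cyc3; exists u.
by exists u => //; apply/eqP; rewrite eq_cyc3.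
Qed.

Lemma eq_orient l l' : (orient l == orient l') = same_cyclic l l'.
Proof.
rewrite eqEsubset; congr (_ && _); apply/subsetP/allP => [H t lt|H C].
- by rewrite -mem_orient H // inE map_f.
- by rewrite inE => /mapP[t lt ->]; rewrite mem_orient H.
- by rewrite -mem_orient H // inE map_f.
- by rewrite inE => /mapP[t lt ->]; rewrite mem_orient H.
Qed.

Lemma cyc3_flip t : cyc3 (flip t) = cyc t.2 t.1.2 t.1.1.
Proof.
by apply/eqP; rewrite -[X in _ == X]/(cyc3 (t.2, t.1.2, t.1.1)) eq_cyc3 !inE eqxx !orbT.
Qed.

Lemma reverse_cyc3 t : reverse_cyc (cyc3 t) = cyc3 (flip t).
Proof.
rewrite cyc3_flip; case: t => [[a b] c] /=; apply/setP=> x.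
apply/imsetP/idP => [[y]|].
  by rewrite !inE -orbA => /or3P[]/eqP-> -> /=; rewrite eqxx ?orbT.
rewrite !inE -orbA => /or3P[]/eqP->.
- by exists (a, b, c); rewrite ?inE ?eqxx ?orbT.
- by exists (c, a, b); rewrite ?inE ?eqxx ?orbT.
- by exists (b, c, a); rewrite ?inE ?eqxx ?orbT.
Qed.

Lemma reverse_orient l : reverse (orient l) = orient (map (@flip T) l).
Proof.
apply/setP=> C; apply/imsetP/idP => [[D]|].
  rewrite inE => /mapP[t lt ->] ->; rewrite reverse_cyc3 inE.
  by rewrite map_f // map_f.
rewrite inE -map_comp => /mapP[t lt ->]; exists (cyc3 t); first by rewrite inE map_f.
by rewrite reverse_cyc3.
Qed.

Lemma supp_cyclic_shifts t u : t \in cyclic_shifts u -> supp t = supp u.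
Proof.
rewrite !inE => /or3P[]/eqP-> //; apply/setP => x; rewrite !inE /=;
by do 3!case: (x == _).
Qed.

Lemma supp_flip t : supp (flip t) = supp t.
Proof. by apply/setP => x; rewrite !inE /=; do 3!case: (x == _). Qed.

Lemma mem_supp t x : (x \in supp t) = (x \in points t).
Proof. by rewrite !inE orbA. Qed.

Lemma cyc3_in_cyclic_orderings t : cyc3 t \in cyclic_orderings (supp t).
Proof. by apply/imsetP; exists t; rewrite ?inE. Qed.

Lemma cyclic_orderings_supp (X : {set T}) C :
  C \in cyclic_orderings X -> exists2 t, C = cyc3 t & supp t = X.
Proof. by case/imsetP => t; rewrite inE => /eqP<- ->; exists t. Qed.

(** Injectivity of [supp] on [l] means that no block receives two entries of the list, hence exactly
    one ordering per block. *)
Lemma orientation_orient l :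
  {in l &, injective (@supp T)} -> orientation [set X in map (@supp T) l] (orient l).
Proof.
move=> sI; apply/andP; split.
  apply/subsetP => C; rewrite inE => /mapP[t lt ->].
  apply/bigcupP; exists (supp t); first by rewrite inE map_f.
  exact: cyc3_in_cyclic_orderings.
apply/forall_inP => X; rewrite inE => /mapP[t lt ->].
apply/cards1P; exists (cyc3 t); apply/setP => C; rewrite !inE.
apply/andP/eqP => [[/mapP[u lu ->] /cyclic_orderings_supp[v uv vt]]|->].
  congr cyc3; apply: sI => //; rewrite -vt; apply: supp_cyclic_shifts.
  by rewrite -eq_cyc3 uv.
by rewrite cyc3_in_cyclic_orderings map_f.
Qed.
End Orient.

(** * Isomorphisms between orientations given by lists *)

Section Isomorphism.
Variables S S' S'' : finType.

Lemma isomorphic_sym (O : {set {set S * S * S}}) (O' : {set {set S' * S' * S'}}) :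
  isomorphic O O' -> isomorphic O' O.
Proof.
case=> f [g fK gK] /'forall_'forall_'forall_eqP H; exists g; first by exists f.
by apply/'forall_'forall_'forall_eqP => a b c; rewrite H !gK.
Qed.

Lemma isomorphic_trans (O : {set {set S * S * S}}) (O' : {set {set S' * S' * S'}})
  (O'' : {set {set S'' * S'' * S''}}) :
  isomorphic O O' -> isomorphic O' O'' -> isomorphic O O''.
Proof.
case=> f fB /'forall_'forall_'forall_eqP H [g gB /'forall_'forall_'forall_eqP H'].
exists (g \o f); first exact: bij_comp.
by apply/'forall_'forall_'forall_eqP => a b c; rewrite H H'.
Qed.

(** [preserves_orientation] only tests sets of the form [cyc a b c], so [O'] must consist of such
    sets to be determined by [f]. Surjectivity of [f] then turns each of them into the image of an
    ordering in the source. *)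
Lemma preserves_orient (f : S -> S') l O' : bijective f ->
  preserves_orientation (orient l) O' f ->
  (forall C, C \in O' -> exists t, C = cyc3 t) ->
  O' = orient (map (map3 f) l).
Proof.
case=> g fK gK /'forall_'forall_'forall_eqP H HO.
apply/setP => C; apply/idP/idP => [OC|].
  have [[[a b] c] E] := HO _ OC; move: OC; rewrite E /cyc3 /= -[a]gK -[b]gK -[c]gK -H.
  rewrite -/(cyc3 (g a, g b, g c)) inE => /mapP[t lt /eqP]; rewrite eq_cyc3 => tt.
  rewrite -/(cyc3 (map3 f (g a, g b, g c))) mem_orient; apply/hasP.
  exists (map3 f t); rewrite ?map_f // mem_cyclic_shifts_map3 //; exact: can_inj fK.
by rewrite inE -map_comp => /mapP[t lt ->]; rewrite /cyc3 /= -H inE (map_f (@cyc3 _)).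
Qed.

Lemma preserves_orient_map (f : S -> S') l : injective f ->
  preserves_orientation (orient l) (orient (map (map3 f) l)) f.
Proof.
move=> fI; apply/'forall_'forall_'forall_eqP => a b c.
rewrite -/(cyc3 (a, b, c)) -/(cyc3 (map3 f (a, b, c))) !mem_orient has_map.
by apply: eq_has => u /=; rewrite mem_cyclic_shifts_map3.
Qed.

Lemma preserves_orientE (f : S -> S') l l' : bijective f ->
  preserves_orientation (orient l) (orient l') f =
  same_cyclic (map (map3 f) l) l'.
Proof.
move=> fB; rewrite -eq_orient; apply/idP/eqP => [H|<-].
  by rewrite -(preserves_orient fB H) // => C; rewrite inE => /mapP[t _ ->]; exists t.
exact/preserves_orient_map/bij_inj.
Qed.
End Isomorphism.

(** * Permutations as lists of numbers, and isomorphism as a finite search *)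

Section Words.
Variable n : nat.
Definition word (f : 'I_n -> 'I_n) : seq nat := [seq val (f i) | i <- enum 'I_n].
Definition words := permutations (iota 0 n).

Lemma nth_word f (i : 'I_n) : nth 0 (word f) i = f i.
Proof. by rewrite (nth_map i) ?size_enum_ord // nth_ord_enum. Qed.

Lemma word_in f : injective f -> word f \in words.
Proof.
move=> fI; have U : uniq (word f) by rewrite map_inj_uniq ?enum_uniq // => i j /val_inj/fI.
rewrite mem_permutations; apply: uniq_perm; rewrite ?iota_uniq //.
have sub : {subset word f <= iota 0 n} by move=> x /mapP[i _ ->]; rewrite mem_iota ltn_ord.
(* Pigeonhole: a duplicate-free list inside [iota 0 n] and of the same length has the same
   elements. *)
by have [] := uniq_min_size U sub; rewrite // size_iota size_map size_enum_ord.
Qed.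

Lemma words_word p : p \in words -> exists s : 'S_n, p = word s.
Proof.
rewrite mem_permutations => P.
have sp : size p = n by rewrite (perm_size P) size_iota.
have lt (i : 'I_n) : nth 0 p i < n.
  have : nth 0 p i \in p by rewrite mem_nth ?sp.
  by rewrite (perm_mem P) mem_iota.
have I : injective (fun i => Ordinal (lt i)).
  move=> i j [] /eqP; rewrite nth_uniq ?sp // ?(perm_uniq P) ?iota_uniq //.
  by move=> /eqP/val_inj.
exists (perm I); apply: (@eq_from_nth _ 0) => [|i].
  by rewrite size_map size_enum_ord.
by rewrite sp => ltin; rewrite (nth_word _ (Ordinal ltin)) permE.
Qed.

Lemma word_perm_inj : injective (fun s : 'S_n => word s).
Proof. by move=> s t E; apply/permP => i; apply/val_inj; rewrite /= -!nth_word E. Qed.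

(** Ordinals are replaced by their values, so that the searches run on plain numbers. *)
Definition code (l : seq ('I_n * 'I_n * 'I_n)) := map (map3 val) l.
Definition maps_to l l' (p : seq nat) := same_cyclic (map (map3 (nth 0 p)) l) l'.

Lemma preserves_word (f : 'I_n -> 'I_n) l l' : injective f ->
  preserves_orientation (orient l) (orient l') f = maps_to (code l) (code l') (word f).
Proof.
move=> fI; rewrite preserves_orientE; last exact: injF_bij.
rewrite -(same_cyclic_map _ _ val_inj) /maps_to -!map_comp.
congr same_cyclic; apply: eq_map => -[[a b] c]; by rewrite /map3 /= !nth_word.
Qed.

Lemma isomorphicP l l' :
  reflect (isomorphic (orient l) (orient l')) (has (maps_to (code l) (code l')) words).
Proof.
apply: (iffP hasP) => [[p pw]|[f fB]].
  have [s ->] := words_word pw; rewrite -preserves_word; last exact: perm_inj.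
  by exists s => //; apply: injF_bij; apply: perm_inj.
have fI := bij_inj fB.
by rewrite preserves_word //; exists (word f); rewrite ?word_in.
Qed.

Lemma mem_oaut l (s : 'S_n) : (s \in oaut (orient l)) = maps_to (code l) (code l) (word s).
Proof. by rewrite inE preserves_word //; apply: perm_inj. Qed.

(** [word] is injective and its values are exactly the members of [words], so it matches
    automorphisms with the words that pass the test. *)
Lemma card_oaut l : #|oaut (orient l)| = count (maps_to (code l) (code l)) words.
Proof.
rewrite cardE -(size_map (fun s : 'S_n => word s)) -size_filter; apply/perm_size/uniq_perm.
- by rewrite map_inj_uniq ?enum_uniq //; apply: word_perm_inj.
- by rewrite filter_uniq ?permutations_uniq.
move=> p; rewrite mem_filter; apply/mapP/andP => [[s]|[H /words_word[s E]]].
  by rewrite mem_enum mem_oaut => H ->; rewrite word_in //; apply: perm_inj.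
by exists s => //; rewrite mem_enum mem_oaut -E.
Qed.

Lemma abelian_oaut l : abelian (oaut (orient l)) ->
  {in [seq p <- words | maps_to (code l) (code l) p] &, forall p q i,
     i < n -> nth 0 p (nth 0 q i) = nth 0 q (nth 0 p i)}.
Proof.
move=> /centsP ab p q; rewrite !mem_filter => /andP[Hp /words_word[s Es]].
move=> /andP[Hq /words_word[t Et]] i lti; rewrite Es Et in Hp Hq *.
rewrite -!mem_oaut in Hp Hq; have /permP/(_ (Ordinal lti)) := ab _ Hp _ Hq.
rewrite !permM => /(congr1 val) /=.
by rewrite -!nth_word /= => ->.
Qed.

End Words.

(** * Enumeration of the sign choices *)

Fixpoint flips (T : Type) (l : seq (T * T * T)) : seq (seq (T * T * T)) :=
  if l is t :: l' then [seq u :: r | u <- [:: t; flip t], r <- flips l'] else [:: [::]].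

Lemma mem_flips (T : eqType) (P : pred (T * T * T)) (l : seq (T * T * T)) :
  [seq if P t then t else flip t | t <- l] \in flips l.
Proof.
elim: l => //= t l IH; rewrite mem_cat cats0.
by case: (P t); rewrite map_f ?orbT.
Qed.

Lemma card_supp (S : finType) (t : S * S * S) : (#|supp t| == 3) = uniq (points t).
Proof.
have -> : supp t = [set x in points t] by apply/setP => x; rewrite mem_supp inE.
by rewrite cardsE; apply/eqP/idP => [/(@card_uniqP _ (points t))|/card_uniqP->].
Qed.

(** * Blocks of a Steiner triple system *)

Section SteinerTripleSystem.
Variables (S : finType) (T : {set {set S}}).
Hypothesis sts : steiner_triple_system T.

Lemma card_triple X : X \in T -> #|X| = 3.
Proof. by case/andP: sts => /forall_inP H _ /H/eqP. Qed.

(** The five other orders are bundled in a product, so that a single rewrite recognises a block in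
    whatever order its points appear. *)
Lemma triple_perm x y z : (supp (x, y, z) \in T) ->
  (supp (y, x, z) \in T) * (supp (x, z, y) \in T) * (supp (z, y, x) \in T)
  * (supp (y, z, x) \in T) * (supp (z, x, y) \in T).
Proof.
move=> H; do !split; by rewrite [X in X \in T](_ : _ = supp (x, y, z)) //;
  apply/setP => w; rewrite !inE /=; do 3!case: (w == _).
Qed.

Lemma triple_neq x y z : supp (x, y, z) \in T -> (x != y) * (x != z) * (y != z).
Proof.
move/card_triple/eqP; rewrite card_supp /= !inE negb_or andbT.
by move=> /andP[/andP[-> ->] ->].
Qed.

Lemma triple_exists x y : x != y -> exists z, supp (x, y, z) \in T.
Proof.
move=> nxy; case/andP: sts => _ /forall_inP/(_ [set x; y]).
(* Evaluating the singleton at its own member [X] shows that [X] is a block containing [x] and [y];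
   removing these two from its three points leaves [z]. *)
rewrite cards2 nxy => /(_ isT)/cards1P[X /setP/(_ X)]; rewrite !inE eqxx.
case/andP => XT sX; have cX := card_triple XT.
have : #|X :\: [set x; y]| == 1 by rewrite cardsDS // cX cards2 nxy.
case/cards1P => z Ez; exists z.
suff -> : supp (x, y, z) = X by [].
by rewrite -(setID X [set x; y]) (setIidPr sX) Ez.
Qed.

Lemma triple_unique (X Y : {set S}) x y : X \in T -> Y \in T -> x != y ->
  x \in X -> y \in X -> x \in Y -> y \in Y -> X = Y.
Proof.
move=> XT YT nxy xX yX xY yY; case/andP: sts => _ /forall_inP/(_ [set x; y]).
rewrite cards2 nxy => /(_ isT)/cards1P[Z /setP H].
have := H X; have := H Y; rewrite !inE XT YT !subUset !sub1set xX yX xY yY /=.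
by move=> /esym/eqP-> /esym/eqP->.
Qed.

Lemma third_unique x y z w :
  supp (x, y, z) \in T -> supp (x, y, w) \in T -> z = w.
Proof.
move=> Hz Hw; have [[nxy nxz] nyz] := triple_neq Hz.
have E : supp (x, y, z) = supp (x, y, w).
  by apply: (triple_unique Hz Hw nxy); rewrite !inE eqxx ?orbT.
have : z \in supp (x, y, w) by rewrite -E !inE eqxx orbT.
by rewrite !inE /= ![z == _]eq_sym (negPf nxz) (negPf nyz) => /eqP.
Qed.

End SteinerTripleSystem.

(** * An orientation as a choice of sign on each block *)

Lemma cyc3_same_supp (S : finType) (t u : S * S * S) : uniq (points t) ->
  supp u = supp t -> cyc3 u = cyc3 t \/ cyc3 u = cyc3 (flip t).
Proof.
case: t u => [[a b] c] [[x y] z] /=; rewrite !inE negb_or andbT => /andP[/andP[nab nac] nbc].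
move=> /setP E.
suff: ((x, y, z) \in cyclic_shifts (a, b, c)) ||
    ((x, y, z) \in cyclic_shifts (a, c, b)).
  by rewrite -!eq_cyc3 => /orP[]/eqP; [left|right].
have := E x; have := E y; have := E z; rewrite !inE !eqxx ?orbT /= -!orbA.
have := E a; have := E b; have := E c; rewrite !inE !eqxx ?orbT /= -!orbA.
move=> Ec Eb Ea /esym/or3P Ez /esym/or3P Ey /esym/or3P Ex.
have N := (negPf nab, negPf nac, negPf nbc).
have N' : ((b == a) = false) * ((c == a) = false) * ((c == b) = false).
  by rewrite ![_ == a]eq_sym [c == b]eq_sym !N.
(* Of the 27 placements of [x], [y], [z] among [a], [b], [c], those repeating a point miss another
   one and contradict [Ea], [Eb] or [Ec]. The remaining six are the rotations of the two orders. *)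
by case: Ex Ea Eb Ec => /eqP->; case: Ey => /eqP->; case: Ez => /eqP->;
  rewrite ?eqxx ?N ?N' //= !xpair_eqE ?eqxx ?orbT.
Qed.

(** Each block has two cyclic orderings and [O] contains exactly one, so asking whether [O] contains
    the listed one decides the sign, and the signs recover [O]. *)
Lemma orientation_orientE (S : finType) (l : seq (S * S * S)) (O : {set {set S * S * S}}) :
  (forall t, t \in l -> uniq (points t)) ->
  orientation [set X in map (@supp S) l] O ->
  O = orient [seq if cyc3 t \in O then t else flip t | t <- l].
Proof.
move=> U /andP[/subsetP sub /forall_inP card1].
have choice t : t \in l -> cyc3 (if cyc3 t \in O then t else flip t) \in O
    /\ forall C, C \in O -> C \in cyclic_orderings (supp t) ->
       C = cyc3 (if cyc3 t \in O then t else flip t).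
  move=> lt; have /card1/cards1P[C /setP E] : supp t \in [set X in map (@supp S) l].
    by rewrite inE map_f.
  have inO : cyc3 (if cyc3 t \in O then t else flip t) \in O.
    case: ifPn => // tO; have := E C; rewrite !inE eqxx => /andP[CO].
    case/cyclic_orderings_supp => u Eu /(cyc3_same_supp (U _ lt)) [] E'.
      by rewrite -E' -Eu CO in tO.
    by rewrite -E' -Eu.
  split=> // D DO Dt; have := E D; rewrite !inE DO Dt => /esym/eqP->.
  have := E (cyc3 (if cyc3 t \in O then t else flip t)); rewrite !inE inO.
  have -> : supp t = supp (if cyc3 t \in O then t else flip t).
    by case: ifP; rewrite ?supp_flip.
  by rewrite cyc3_in_cyclic_orderings => /esym/eqP->.
apply/setP => C; apply/idP/idP => [CO|].
  have /bigcupP[X] := sub _ CO; rewrite inE => /mapP[t lt ->] Ct.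
  by rewrite ((choice _ lt).2 _ CO Ct) inE !map_f.
by rewrite inE -map_comp => /mapP[t lt ->]; case: (choice _ lt).
Qed.

(** * The Fano plane and its uniqueness *)

Definition L1 := [:: (pt 1, pt 2, pt 3); (pt 1, pt 4, pt 5); (pt 1, pt 6, pt 7);
  (pt 2, pt 4, pt 6); (pt 2, pt 7, pt 5); (pt 3, pt 6, pt 5); (pt 3, pt 7, pt 4)].
Definition L2 := [:: (pt 1, pt 2, pt 3); (pt 1, pt 4, pt 5); (pt 1, pt 7, pt 6);
  (pt 2, pt 4, pt 6); (pt 2, pt 5, pt 7); (pt 3, pt 4, pt 7); (pt 3, pt 6, pt 5)].
(** Every triple is increasing here, in the order used for [fano], so this list also serves as the
    reference list of lines. *)
Definition L3 := [:: (pt 1, pt 2, pt 3); (pt 1, pt 4, pt 5); (pt 1, pt 6, pt 7);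
  (pt 2, pt 4, pt 6); (pt 2, pt 5, pt 7); (pt 3, pt 4, pt 7); (pt 3, pt 5, pt 6)].
Definition L4 := [:: (pt 1, pt 2, pt 3); (pt 1, pt 4, pt 5); (pt 1, pt 6, pt 7);
  (pt 2, pt 4, pt 6); (pt 2, pt 5, pt 7); (pt 3, pt 4, pt 7); (pt 3, pt 6, pt 5)].
Lemma O1E : O1 = orient L1. Proof. by []. Qed.
Lemma O2E : O2 = orient L2. Proof. by []. Qed.
Lemma O3E : O3 = orient L3. Proof. by []. Qed.
Lemma O4E : O4 = orient L4. Proof. by []. Qed.
Lemma fanoE : fano = [set X in map (@supp 'I_7) L3]. Proof. by []. Qed.

(** A check of all 49 pairs of numbers. A one-element filter gives both existence and uniqueness of
    the line. *)
Lemma fano_line (i j : 'I_7) : i != j ->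
  exists t, [seq u <- L3 | (i \in points u) && (j \in points u)] = [:: t].
Proof.
pose thru i j (t : nat * nat * nat) := (i \in points t) && (j \in points t).
have /allP/(_ (val i))/[!mem_iota]/(_ (ltn_ord i)) :
  all (fun i => all (fun j => (i == j) || (count (thru i j) (code L3) == 1))
    (iota 0 7)) (iota 0 7).
  by [].
move=> /allP/(_ (val j))/[!mem_iota]/(_ (ltn_ord j)).
rewrite val_eqE => /orP[->//|/[swap] _]; rewrite count_map.
rewrite (@eq_count _ _ (fun u => (i \in points u) && (j \in points u))); last first.
  by move=> u; rewrite /thru /= -[points _]/(map val (points u)) !(mem_map val_inj).
by rewrite -size_filter; case: filter => [|t []] // _; exists t.
Qed.

Lemma fano_uniq t : t \in L3 -> uniq (points t).
Proof. by move: t; apply/allP. Qed.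

Lemma fano_sts : steiner_triple_system fano.
Proof.
rewrite fanoE; apply/andP; split; apply/forall_inP => X.
  by rewrite inE => /mapP[t lt ->]; rewrite card_supp fano_uniq.
case/cards2P => i [j [nij ->]]; have [t Et] := fano_line nij.
have {}Et u : (u \in L3) && ([set i; j] \subset supp u) = (u == t).
  have : (u \in [:: t]) = (u == t) by rewrite inE.
  by rewrite -Et mem_filter subUset !sub1set !mem_supp andbC.
apply/cards1P; exists (supp t); apply/setP => X'; rewrite !in_set in_set1.
apply/andP/eqP => [[/mapP[u lu ->] sX]|->].
  by congr supp; apply/eqP; rewrite -Et lu.
by have := Et t; rewrite eqxx => /andP[lt ->]; rewrite map_f.
Qed.

Lemma triple_clash (S : finType) (T : {set {set S}}) x y z w :
  steiner_triple_system T -> supp (x, y, z) \in T -> supp (x, y, w) \in T -> z != w -> False.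
Proof. by move=> sts H H'; rewrite (third_unique sts H H') eqxx. Qed.

(** Refutes a case in which two blocks share [x] and [y] but have distinct third points [z] and
    [w]. *)
Ltac by_clash sts x y z w :=
  exfalso; apply: (@triple_clash _ _ x y z w sts);
  solve [ assumption | by rewrite eq_sym
        | match goal with H : is_true (supp _ \in _) |- _ => by rewrite (triple_perm H) end].

Lemma fano_frame (S : finType) (T : {set {set S}}) :
  #|S| = 7 -> steiner_triple_system T ->
  exists2 f : 'I_7 -> S, bijective f & forall t, t \in L3 -> supp (map3 f t) \in T.
Proof.
move=> cS sts; have nT x y z := triple_neq sts (x := x) (y := y) (z := z).
have [a _] : exists a, a \in S by apply/card_gt0P; rewrite cS.
have [b] : exists b, b \in [set~ a] by apply/card_gt0P; rewrite cardsC1 cS.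
rewrite !inE eq_sym => nab.
have [c abc] := triple_exists sts nab; have [[_ nac] nbc] := nT _ _ _ abc.
have [d] : exists d, d \in ~: supp (a, b, c).
  by apply/card_gt0P; rewrite cardsCs setCK cS (card_triple sts abc).
rewrite !inE !negb_or /= ![d == _]eq_sym => /andP[/andP[nad nbd] ncd].
have [e ade] := triple_exists sts nad; have [[_ nae] nde] := nT _ _ _ ade.
have [f bdf] := triple_exists sts nbd; have [[_ nbf] ndf] := nT _ _ _ bdf.
have [g cdg] := triple_exists sts ncd; have [[_ ncg] ndg] := nT _ _ _ cdg.
(* Each coincidence among the constructed points would give two blocks meeting in two points. *)
have nbe : b != e by apply/eqP => E; subst e; by_clash sts a b c d.
have nce : c != e by apply/eqP => E; subst e; by_clash sts a c b d.
have naf : a != f by apply/eqP => E; subst f; by_clash sts a b c d.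
have ncf : c != f by apply/eqP => E; subst f; by_clash sts b c a d.
have nef : e != f by apply/eqP => E; subst f; by_clash sts d e a b.
have nag : a != g by apply/eqP => E; subst g; by_clash sts a c b d.
have nbg : b != g by apply/eqP => E; subst g; by_clash sts b c a d.
have neg : e != g by apply/eqP => E; subst g; by_clash sts d e a c.
have nfg : f != g by apply/eqP => E; subst g; by_clash sts d f b c.
(* The letters take the labels 1 to 7 in order, so the lines of [L3] read [abc], [ade], [afg],
   [bdf], [beg], [cdg], [cef]; the third, fifth and seventh remain to be proved. *)
pose s := [:: a; b; c; d; e; f; g].
have Us : uniq s.
  by rewrite /= !inE !negb_or nab nac nad nae naf nag nbc nbd nbe nbf nbg ncd nce
    ncf ncg nde ndf ndg nef neg nfg.
have inj : injective (fun i : 'I_7 => nth a s i).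
  by move=> i j /eqP; rewrite nth_uniq // => /eqP/val_inj.
have bij : bijective (fun i : 'I_7 => nth a s i) by apply: inj_card_bij; rewrite ?cS ?card_ord.
have ins x : x \in s.
  by have [h _ hK] := bij; rewrite -[x]hK mem_nth.
have afg : supp (a, f, g) \in T.
  (* The third point is one of the seven. Any choice but [g] repeats [a] or [f], or yields a second
     block through a pair already covered; the next two blocks follow likewise. *)
  have [x afx] := triple_exists sts naf; have [[_ nax] nfx] := nT _ _ _ afx.
  have:= ins x; rewrite !inE => /or4P[||| /or4P[]] /eqP E; subst x => //.
  - by rewrite eqxx in nax.
  - by_clash sts a b c f.
  - by_clash sts a c b f.
  - by_clash sts a d e f.
  - by_clash sts a e d f.
  - by rewrite eqxx in nfx.
have beg : supp (b, e, g) \in T.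
  have [x bex] := triple_exists sts nbe; have [[_ nbx] nex] := nT _ _ _ bex.
  have:= ins x; rewrite !inE => /or4P[||| /or4P[]] /eqP E; subst x => //.
  - by_clash sts a b c e.
  - by rewrite eqxx in nbx.
  - by_clash sts b c a e.
  - by_clash sts b d f e.
  - by rewrite eqxx in nex.
  - by_clash sts b f d e.
have cef : supp (c, e, f) \in T.
  have [x cex] := triple_exists sts nce; have [[_ ncx] nex] := nT _ _ _ cex.
  have:= ins x; rewrite !inE => /or4P[||| /or4P[]] /eqP E; subst x => //.
  - by_clash sts a c b e.
  - by_clash sts b c a e.
  - by rewrite eqxx in ncx.
  - by_clash sts c d g e.
  - by rewrite eqxx in nex.
  - by_clash sts c g d e.
exists (fun i : 'I_7 => nth a s i) => // t.
by rewrite !inE => /or4P[||| /or4P[]] /eqP->.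
Qed.

(** The frame gives seven blocks. Any block contains two points, their preimages lie on a line of
    [L3], and the image of that line shares both points with the block, hence equals it. *)
Lemma fano_unique (S : finType) (T : {set {set S}}) :
  #|S| = 7 -> steiner_triple_system T ->
  exists2 f : 'I_7 -> S, bijective f & T = [set X in map (@supp S) (map (map3 f) L3)].
Proof.
move=> cS sts; have [f fB fT] := fano_frame cS sts; exists f => //.
apply/setP => X; rewrite inE; apply/idP/idP => [XT|]; last first.
  by rewrite -map_comp => /mapP[t /fT lt ->].
have [g _ gK] := fB.
have /card_gt1P[x [y [xX yX nxy]]] : 1 < #|X| by rewrite (card_triple sts XT).
have ngxy : g x != g y by rewrite (can_eq gK).
have [t Et] := fano_line ngxy.
have : t \in [seq u <- L3 | (g x \in points u) && (g y \in points u)] by rewrite Et inE.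
rewrite mem_filter => /andP[/andP[xt yt] lt].
rewrite (triple_unique sts XT (fT _ lt) nxy xX yX) ?map_f //.
  by rewrite mem_supp -[x]gK (map_f f xt).
by rewrite mem_supp -[y]gK (map_f f yt).
Qed.

(** * Classification of the orientations *)

(** Adjoining the flipped lines forgets orientation, so these are the 168 automorphisms of the
    unoriented plane. Any isomorphism between two of its orientations is among them, which shortens
    the search. *)
Definition collineations := [seq p <- words 7 |
  sub_cyclic (map (map3 (nth 0 p)) (code L3)) (code (L3 ++ map (@flip _) L3))].

(* Left to the kernel's lazy conversion: the virtual machine is strict, so [has]
   and [all] would not stop early.  The [let] shares the list of collineations. *)
Lemma flips_classified : let cs := collineations in
  all (fun l => has (fun p =>
         has (fun l' => maps_to (code l) (code l') p) [:: L1; L2; L3; L4]) cs)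
    (flips L3).
Proof. exact_no_check (erefl true). Qed.

Lemma classification (S : finType) (T : {set {set S}}) (O : {set {set S * S * S}}) :
  #|S| = 7 -> oriented_STS T O ->
  exists2 l, l \in [:: L1; L2; L3; L4] & isomorphic O (orient l).
Proof.
move=> cS /andP[sts oO]; have [f fB ET] := fano_unique cS sts.
have fI := bij_inj fB.
(* [P] reads the sign that [O] gives to the image of each line, so [m] is the orientation of the
   standard plane pulled back along [f]. *)
pose P t := cyc3 (map3 f t) \in O; pose m := [seq if P t then t else flip t | t <- L3].
have EO : O = orient (map (map3 f) m).
  rewrite ET in oO; rewrite (orientation_orientE _ oO).
    by rewrite -!map_comp; congr orient; apply: eq_map => t /=; rewrite -/(P t); case: ifP.
  by move=> t /mapP[u lu ->]; rewrite -[points _]/(map f (points u)) map_inj_uniq ?fano_uniq.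
have /hasP[p] := allP flips_classified _ (mem_flips P L3).
rewrite mem_filter => /andP[_ pw] /hasP[l' ll H]; exists l' => //.
apply: (@isomorphic_trans _ 'I_7 _ _ (orient m)).
  by apply: isomorphic_sym; exists f; rewrite // EO preserves_orient_map.
by apply/isomorphicP/hasP; exists p.
Qed.

Lemma oriented_fano (l : seq ('I_7 * 'I_7 * 'I_7)) :
  l \in [:: L1; L2; L3; L4] -> oriented_STS fano (orient l).
Proof.
move=> ll; rewrite /oriented_STS fano_sts /=.
(* A test on numbers implied by equality of supports; it suffices to separate the lines of each
   list. *)
pose same (t u : nat * nat * nat) := all (mem (points t)) (points u).
have sameP (t u : 'I_7 * 'I_7 * 'I_7) : supp t = supp u -> same (map3 val t) (map3 val u).
  move=> E; apply/allP => x; rewrite -[points _]/(map val (points u)) => /mapP[y yu ->].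
  rewrite /= -[points _]/(map val (points t)) (mem_map val_inj).
  by rewrite -mem_supp E mem_supp.
have inj : {in l &, injective (@supp 'I_7)}.
  have : all (fun t => all (fun u => same t u ==> (t == u)) (code l)) (code l).
    by move: l ll; apply/allP.
  move=> /allP H t u lt lu /sameP E; apply: (map3_inj val_inj).
  have /allP/(_ (map3 val u) (map_f _ lu)) := H _ (map_f _ lt).
  by rewrite E => /eqP.
suff -> : fano = [set X in map (@supp 'I_7) l] by apply: orientation_orient.
(* In all four lists each line starts with its smallest point, so the lists agree up to [flip]
   alone, without rotations. *)
have fl (l1 l2 : seq ('I_7 * 'I_7 * 'I_7)) :
    all (fun t => (t \in l2) || (flip t \in l2)) l1 ->
    {subset map (@supp 'I_7) l1 <= map (@supp 'I_7) l2}.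
  move=> /allP H X /mapP[t /H/orP[] lt ->]; first exact: map_f.
  by rewrite -supp_flip map_f.
rewrite fanoE; apply/setP => X; rewrite !in_set.
by apply/idP/idP; apply: fl X; move: l ll {inj}; apply/allP.
Qed.

(** * Isomorphism tests, automorphism groups and the theorem *)

Ltac search :=
  rewrite ?O1E ?O2E ?O3E ?O4E ?reverse_orient; apply/isomorphicP;
  vm_cast_no_check (erefl true).

Ltac search_fails :=
  rewrite /reflexive_orientation ?O1E ?O2E ?O3E ?O4E ?reverse_orient;
  move=> /isomorphicP; apply/negP; vm_cast_no_check (erefl true).

Lemma not_abelian_oaut l p q i : i < 7 -> p \in words 7 -> q \in words 7 ->
  maps_to (code l) (code l) p -> maps_to (code l) (code l) q ->
  nth 0 p (nth 0 q i) != nth 0 q (nth 0 p i) -> ~~ abelian (oaut (@orient 'I_7 l)).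
Proof.
move=> lti pw qw Hp Hq; apply: contra => /abelian_oaut H.
by rewrite (H p q) ?mem_filter ?Hp ?Hq.
Qed.

Theorem theorem1 :
  [/\ oriented_STS fano O1, oriented_STS fano O2,
      oriented_STS fano O3 & oriented_STS fano O4]
  /\ ([/\ ~ isomorphic O1 O2, ~ isomorphic O1 O3 & ~ isomorphic O1 O4]
      /\ [/\ ~ isomorphic O2 O3, ~ isomorphic O2 O4 & ~ isomorphic O3 O4])
  /\ (forall (S : finType) (T : {set {set S}}) (O : {set {set S * S * S}}),
        #|S| = 7 -> oriented_STS T O ->
        [\/ isomorphic O O1, isomorphic O O2,
            isomorphic O O3 | isomorphic O O4])
  /\ (#|oaut O1| = 21 /\ ~~ abelian (oaut O1))
  /\ (#|oaut O2| = 21 /\ ~~ abelian (oaut O2))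
  /\ (cyclic (oaut O3) /\ #|oaut O3| = 3)
  /\ (cyclic (oaut O4) /\ #|oaut O4| = 3)
  /\ [/\ ~ reflexive_orientation O1, ~ reflexive_orientation O2,
         ~ reflexive_orientation O3 & ~ reflexive_orientation O4]
  /\ isomorphic (reverse O1) O2
  /\ isomorphic (reverse O3) O4.
Proof.
have card3 : #|oaut O3| = 3 by rewrite O3E card_oaut; vm_cast_no_check (erefl 3).
have card4 : #|oaut O4| = 3 by rewrite O4E card_oaut; vm_cast_no_check (erefl 3).
split; first by rewrite O1E O2E O3E O4E; split; apply: oriented_fano; rewrite !inE eqxx ?orbT.
split; first by split; split; search_fails.
split.
  move=> S T O cS /(classification cS)[l]; rewrite !inE => /or4P[]/eqP-> H.
  - by constructor 1.
  - by constructor 2.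
  - by constructor 3.
  - by constructor 4.
split.
  rewrite O1E; split; first by rewrite card_oaut; vm_cast_no_check (erefl 21).
  (* Two automorphisms of order 3: the first fixes 0, the second cycles 0, 1, 2. Their two
     composites send 0 to 3 and to 1. *)
  exact: (@not_abelian_oaut _ [:: 0; 3; 4; 5; 6; 1; 2] [:: 1; 2; 0; 6; 4; 3; 5] 0).
split.
  rewrite O2E; split; first by rewrite card_oaut; vm_cast_no_check (erefl 21).
  (* Again one automorphism fixes 0 and the other cycles 0, 1, 2, and the composites send 0 to 3 and
     to 1. *)
  exact: (@not_abelian_oaut _ [:: 0; 3; 4; 6; 5; 2; 1] [:: 1; 2; 0; 3; 5; 6; 4] 0).
split; first by split => //; apply: prime_cyclic; rewrite card3.
split; first by split => //; apply: prime_cyclic; rewrite card4.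
by split; [split; search_fails | split; search].
Qed.
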